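(* Let $\rho,\sigma$ be $d\times d$ density matrices with $\sigma$ of full rank (invertible). Then \[ \min_{U\in\mathcal{U}(d)} S(U\rho U^\dagger\,\|\,\sigma) = H\big(\lambda^\downarrow(\rho)\,\|\,\lambda^\downarrow(\sigma)\big),\qquad \max_{U\in\mathcal{U}(d)} S(U\rho U^\dagger\,\|\,\sigma) = H\big(\lambda^\downarrow(\rho)\,\|\,\lambda^\uparrow(\sigma)\big), \] and moreover the set $\{S(U\rho U^\dagger\|\sigma): U\in\mathcal{U}(d)\}$ equals the closed interval $\big[H(\lambda^\downarrow(\rho)\|\lambda^\downarrow(\sigma)),\ H(\lambda^\downarrow(\rho)\|\lambda^\uparrow(\sigma))\big]$.
   Context: A density matrix is a positive semidefinite complex matrix of trace one; $\mathcal{U}(d)$ is the group of $d\times d$ unitary matrices. The quantum relative entropy is $S(\rho\|\sigma)=\operatorname{Tr}[\rho(\log\rho-\log\sigma)]$ (defined when $\operatorname{supp}\rho\subseteq\operatorname{supp}\sigma$, with the convention $0\log 0=0$). For probability vectors $p,q$, the classical relative entropy is $H(p\|q)=\sum_j p_j(\log p_j-\log q_j)$ if $\operatorname{supp}(p)\subseteq\operatorname{supp}(q)$ (with $0\log 0=0$), and $+\infty$ otherwise. For a Hermitian matrix $A$, $\lambda^\downarrow(A)$ is the vector of its eigenvalues (with multiplicity) in decreasing order and $\lambda^\uparrow(A)$ the same in increasing order. *)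

(* Defs.v *)
(* classical reals, hand-rolled complex numbers and d x d
   complex matrices (entries outside 0..d-1 are ignored). *)
From Stdlib Require Import Reals Lra List Sorted ClassicalEpsilon.
Open Scope R_scope.

Definition C : Type := (R * R)%type.
Definition RtoC (x : R) : C := (x, 0).
Definition C0 : C := (0, 0).
Definition C1 : C := (1, 0).
Definition Cadd (a b : C) : C := (fst a + fst b, snd a + snd b).
Definition Cmul (a b : C) : C :=
  (fst a * fst b - snd a * snd b, fst a * snd b + snd a * fst b).
Definition Cconj (a : C) : C := (fst a, - snd a).
Definition Re (a : C) : R := fst a.

Fixpoint csum (n : nat) (f : nat -> C) : C :=
  match n with
  | O => C0
  | S m => Cadd (csum m f) (f m)
  end.

Definition Mat : Type := nat -> nat -> C.
Definition zeroM : Mat := fun _ _ => C0.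
Definition idM : Mat := fun i j => if Nat.eqb i j then C1 else C0.
Definition mmul (d : nat) (A B : Mat) : Mat :=
  fun i j => csum d (fun k => Cmul (A i k) (B k j)).
Definition adj (A : Mat) : Mat := fun i j => Cconj (A j i).
Definition diagM (l : nat -> R) : Mat :=
  fun i j => if Nat.eqb i j then RtoC (l i) else C0.
Definition trace (d : nat) (A : Mat) : C := csum d (fun i => A i i).

Definition meq (d : nat) (A B : Mat) : Prop :=
  forall i j, (i < d)%nat -> (j < d)%nat -> A i j = B i j.

Definition unitary (d : nat) (U : Mat) : Prop :=
  meq d (mmul d U (adj U)) idM /\ meq d (mmul d (adj U) U) idM.

Definition hermitian (d : nat) (A : Mat) : Prop :=
  forall i j, (i < d)%nat -> (j < d)%nat -> A i j = Cconj (A j i).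

Definition psd (d : nat) (A : Mat) : Prop :=
  hermitian d A /\
  forall x : nat -> C,
    0 <= Re (csum d (fun i => Cmul (Cconj (x i))
                               (csum d (fun j => Cmul (A i j) (x j))))).

Definition density (d : nat) (A : Mat) : Prop :=
  psd d A /\ trace d A = C1.

Definition invertible (d : nat) (A : Mat) : Prop :=
  exists B, meq d (mmul d A B) idM /\ meq d (mmul d B A) idM.

Definition conjU (d : nat) (U A : Mat) : Mat := mmul d (mmul d U A) (adj U).

Definition spectral (d : nat) (A V : Mat) (l : nat -> R) : Prop :=
  unitary d V /\ meq d A (conjU d V (diagM l)).

(* f(A) for Hermitian A, through a (chosen) spectral decomposition *)
Definition funM (d : nat) (f : R -> R) (A : Mat) : Mat :=
  let p := epsilon (inhabits (zeroM, fun _ : nat => 0))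
                   (fun p : Mat * (nat -> R) => spectral d A (fst p) (snd p)) in
  conjU d (fst p) (diagM (fun i => f (snd p i))).

(* x log x with the convention 0 log 0 = 0 *)
Definition xlogx (x : R) : R := if Rle_dec x 0 then 0 else x * ln x.

(* quantum relative entropy S(rho||sigma) = Tr[rho log rho] - Tr[rho log sigma],
   for sigma of full rank (so the support condition holds automatically). *)
Definition qrelent (d : nat) (rho sigma : Mat) : R :=
  Re (trace d (funM d xlogx rho)) - Re (trace d (mmul d rho (funM d ln sigma))).

Definition eig_dec_spec (d : nat) (A : Mat) (l : list R) : Prop :=
  length l = d /\ Sorted Rge l /\
  exists V, spectral d A V (fun i => nth i l 0).

Definition eig_dec (d : nat) (A : Mat) : list R :=
  epsilon (inhabits nil) (eig_dec_spec d A).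
Definition eig_inc (d : nat) (A : Mat) : list R := rev (eig_dec d A).

(* ---------- classical relative entropy, None = +infinity ---------- *)
Fixpoint relH (p q : list R) : option R :=
  match p, q with
  | x :: p', y :: q' =>
      match relH p' q' with
      | None => None
      | Some r =>
          if Req_EM_T x 0 then Some r
          else if Req_EM_T y 0 then None
          else Some (x * (ln x - ln y) + r)
      end
  | _, _ => Some 0
  end.

(* Main.v *)
(** Diagonalise rho = V diag(p) V* and sigma = W diag(q) W*. Then
    S(U rho U* || sigma) = sum_j p_j log p_j - sum_(i,j) |T_ij|^2 (log q_i) p_j,
    where T = W* U V runs over all unitaries as U does. The matrix |T_ij|^2 is
    bistochastic, so Abel summation (the rearrangement inequality) bounds the
    double sum by its values at the identity and at the reversal permutation J.
    For 0 <= c <= 1 the matrix sqrt(c) 1 + i sqrt(1 - c) J is unitary because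
    J is a Hermitian involution, and the double sum there is the convex
    combination with weights c, 1 - c of the two extremes; hence every value
    in between is attained. *)
From Stdlib Require Import Reals List Sorted ClassicalEpsilon.
From mathcomp Require Import all_boot all_order all_algebra all_fingroup.
From mathcomp Require Import Rstruct complex.
From mathcomp Require Import ring lra zify.
Require Import Defs.
Import GRing.Theory Num.Theory Order.TTheory.
Open Scope R_scope.
Set Implicit Arguments.
Unset Strict Implicit.

(** * Rearrangement inequality for bistochastic matrices, by Abel summation *)

Section Rearrangement.
Local Open Scope ring_scope.
Variable F : realFieldType.
Implicit Types (a b x : nat -> F) (M : nat -> nat -> F) (n k : nat).

Definition nonincreasing n a :=
  forall i j : nat, (i <= j)%N -> (j < n)%N -> a j <= a i.

Definition bistochastic n M :=
  [/\ forall i j, 0 <= M i j,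
      forall i, (i < n)%N -> \sum_(j < n) M i j = 1
    & forall j, (j < n)%N -> \sum_(i < n) M i j = 1].

(** Induction on [n]: lowering the common factor from [a n] to [a n.+1] can only decrease its
    product with a nonnegative partial sum. *)
Lemma abel_ge n a x : nonincreasing n.+1 a ->
  (forall k, (k <= n)%N -> 0 <= \sum_(i < k) x i) ->
  a n * \sum_(i < n.+1) x i <= \sum_(i < n.+1) a i * x i.
Proof.
elim: n => [|n IHn] da sx; first by rewrite !big_ord1.
rewrite big_ord_recr [leRHS]big_ord_recr /= mulrDr lerD2r.
apply: le_trans (IHn _ _).
- by apply: ler_wpM2r; [exact: sx | exact: da].
- by move=> i j ij jn; apply: da => //; exact: leqW.
- by move=> k kn; apply: sx; exact: leqW.
Qed.

(** This is the majorization of [M b] by [b]. The first [k] entries of [M b] add up to a combination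
    of the [b j] with weights [w j] in [0,1] of total [k], which cannot exceed the sum of the [k]
    largest entries. *)
Lemma bistochastic_partial_sum n M b k : bistochastic n M -> nonincreasing n b ->
  (k <= n)%N -> 0 <= \sum_(i < k) (b i - \sum_(j < n) M i j * b j).
Proof.
move=> [M0 Mr Mc] db kn.
pose w j := \sum_(i < k) M i j.
have w0 j : 0 <= w j by apply: sumr_ge0.
have w1 j : (j < n)%N -> w j <= 1.
  move=> jn; rewrite -(Mc j jn) /w (big_ord_widen n (M^~ j) kn) big_mkcond /=.
  by apply: ler_sum => i _; case: ifP.
have sw : \sum_(j < n) ((j < k)%N%:R - w j) = 0.
  rewrite /w sumrB exchange_big /=.
  rewrite [X in _ - X](eq_bigr (fun=> 1)); last first.
    by move=> i _; apply: Mr; exact: leq_trans kn.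
  rewrite (big_ord_widen n (fun=> 1 : F) kn) [X in _ - X]big_mkcond /=.
  by apply/eqP; rewrite subr_eq0; apply/eqP/eq_bigr => j _; case: (_ < _)%N.
(* As sw holds, b may be shifted by b (k - 1), which makes every term >= 0. *)
rewrite [leRHS](_ : _ = \sum_(j < n) ((j < k)%N%:R - w j) * (b j - b k.-1)).
  apply: sumr_ge0 => j _.
  (* Both factors are nonnegative for [j < k] and nonpositive for [k <= j]. If [k = 0], then [k.-1]
     is 0 and only the second case occurs. *)
  have [jk|kj] := ltnP j k.
    by rewrite mulr_ge0 ?subr_ge0 ?w1 //; apply: db; lia.
  rewrite sub0r mulNr -mulrN opprB mulr_ge0 ?subr_ge0 //.
  by apply: db => //; lia.
under [RHS]eq_bigr => j _ do rewrite mulrBr.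
rewrite [RHS]sumrB -[X in _ = _ - X]mulr_suml sw mul0r subr0.
under [RHS]eq_bigr => j _ do rewrite mulrBl mulr_suml.
rewrite !sumrB exchange_big (big_ord_widen n b kn) big_mkcond /=; congr (_ - _).
by apply: eq_bigr => j _; case: ltnP; rewrite ?mul1r ?mul0r.
Qed.

(** The difference of the two sides is the sum of [a i * x i] with [x = b - M b]. The partial sums
    of [x] are nonnegative and its total is 0 by the column sums, so Abel summation bounds the
    difference below by 0. *)
Lemma bistochastic_le n M a b :
  bistochastic n M -> nonincreasing n a -> nonincreasing n b ->
  \sum_(i < n) \sum_(j < n) M i j * a i * b j <= \sum_(i < n) a i * b i.
Proof.
move=> bM da db; rewrite -subr_ge0 -sumrB.
pose x i := b i - \sum_(j < n) M i j * b j.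
rewrite (eq_bigr (fun i : 'I_n => a i * x i)); last first.
  move=> i _; rewrite mulrBr mulr_sumr; congr (_ - _).
  by apply: eq_bigr => j _; ring.
have sx k : (k <= n)%N -> 0 <= \sum_(i < k) x i.
  exact: bistochastic_partial_sum.
have sn : \sum_(i < n) x i = 0.
  case: bM => _ _ Mc; rewrite sumrB exchange_big /= -sumrB big1 // => j _.
  by rewrite -mulr_suml Mc // mul1r subrr.
case: n da {db bM} @x sx sn => [|n] da x sx sn; first by rewrite big_ord0.
rewrite -[leLHS](mulr0 (a n)) -[X in _ * X]sn; apply: abel_ge => // k kn.
by apply: sx; exact: leqW.
Qed.

(** Reversing and negating [a] gives a nonincreasing sequence again, and reversing the rows of [M]
    keeps it bistochastic; the upper bound for these is the lower bound sought. *)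
Lemma bistochastic_ge n M a b :
  bistochastic n M -> nonincreasing n a -> nonincreasing n b ->
  \sum_(i < n) a (n - i.+1)%N * b i <= \sum_(i < n) \sum_(j < n) M i j * a i * b j.
Proof.
move=> [M0 Mr Mc] da db.
pose M' i := M (n - i.+1)%N; pose a' i := - a (n - i.+1)%N.
have bM' : bistochastic n M'.
  split=> [i j|i i_n|j jn]; [exact: M0 | by apply: Mr; lia |].
  by rewrite -(Mc j jn) [RHS](reindex_inj rev_ord_inj).
have da' : nonincreasing n a' by move=> i j ij jn; rewrite lerN2; apply: da; lia.
have := bistochastic_le bM' da' db.
rewrite -lerN2 -!sumrN.
under eq_bigr => i _ do rewrite mulNr opprK.
move=> /le_trans; apply; rewrite (reindex_inj rev_ord_inj) le_eqVlt.
apply/orP; left; apply/eqP/eq_bigr => i _ /=; rewrite -sumrN; apply: eq_bigr => j _; rewrite /M' /a' mulrN mulNr opprK.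
by congr (M _ _ * a _ * _); have := ltn_ord i; lia.
Qed.

End Rearrangement.

(** * Independence of the functional calculus from the diagonalisation *)

Section UnitaryMatrices.
Local Open Scope ring_scope.
Local Open Scope sesquilinear_scope.
Variables (F : numClosedFieldType) (n : nat).
Implicit Types V W T : 'M[F]_n.

Lemma unitarymx_adjV V : V \is unitarymx -> V^t* *m V = 1%:M.
Proof. by move=> /unitarymxP/mulmx1C. Qed.

(** Entrywise the hypothesis says that [l j] and [m i] agree wherever [T i j] is nonzero, and then
    so do their images under [f]. *)
Lemma diag_fun_intertwine T (l m : 'rV[F]_n) (f : F -> F) :
  T *m diag_mx l = diag_mx m *m T ->
  T *m diag_mx (map_mx f l) = diag_mx (map_mx f m) *m T.
Proof.
rewrite !mul_mx_diag !mul_diag_mx => /matrixP Tlm.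
apply/matrixP => i j; move: (Tlm i j); rewrite !mxE.
have [->|Tn0] := eqVneq (T i j) 0; first by rewrite !mul0r !mulr0.
by rewrite (mulrC (m _ _)) => /(mulfI Tn0) ->; rewrite mulrC.
Qed.

(** The change of basis [T = W^* V] intertwines the two diagonals, hence also their images under
    [f]. *)
Lemma spectral_fun_unique V W (l m : 'rV[F]_n) (f : F -> F) :
  V \is unitarymx -> W \is unitarymx ->
  V *m diag_mx l *m V^t* = W *m diag_mx m *m W^t* ->
  V *m diag_mx (map_mx f l) *m V^t* = W *m diag_mx (map_mx f m) *m W^t*.
Proof.
move=> uV uW VW.
have [T uT defV] : exists2 T, T \is unitarymx & V = W *m T.
  exists (W^t* *m V); first by rewrite mul_unitarymx ?trmxC_unitary.
  by rewrite mulmxA (unitarymxP uW) mul1mx.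
have WV : W^t* *m V = T by rewrite defV mulmxA unitarymx_adjV // mul1mx.
have Tl : T *m diag_mx l = diag_mx m *m T.
  have := congr1 (fun X => W^t* *m X *m V) VW.
  rewrite !mulmxA WV (unitarymx_adjV uW) mul1mx -!mulmxA WV.
  by rewrite (unitarymx_adjV uV) mulmx1.
rewrite defV trmx_mul map_mxM -[_ *m T *m _]mulmxA (diag_fun_intertwine f Tl).
by rewrite !mulmxA mulmxtVK.
Qed.

End UnitaryMatrices.

(** * Translation between the concrete complex matrices and MathComp matrices *)

Section Encoding.
Local Open Scope ring_scope.
Local Open Scope sesquilinear_scope.
Definition K : numClosedFieldType := complex R.
Local Notation "x %:K" := (real_complex R x) (at level 2, format "x %:K").

Definition toK (a : C) : K := Complex (fst a) (snd a).
Definition ofK (z : K) : C := (complex.Re z, complex.Im z).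

Lemma toK_inj : injective toK.
Proof. by move=> [a b] [c e] [-> ->]. Qed.

Lemma ofKK : cancel ofK toK. Proof. by case. Qed.

Lemma toK_csum n f : toK (csum n f) = \sum_(i < n) toK (f i).
Proof. by elim: n => [|n IHn]; rewrite ?big_ord0 // big_ord_recr /= -IHn. Qed.

Lemma toKM a b : toK (Cmul a b) = toK a * toK b. Proof. by []. Qed.

Lemma toK_conj a : toK (Cconj a) = (toK a)^*. Proof. by []. Qed.

Section Dimension.
Variable d : nat.
Implicit Types (A B U V W : Mat) (l m : nat -> R).

Definition toM A : 'M[K]_d := \matrix_(i, j) toK (A i j).

Definition ofM (X : 'M[K]_d) : Mat := fun i j =>
  if insub i is Some i' then if insub j is Some j' then ofK (X i' j') else C0
  else C0.

Lemma ofMK : cancel ofM toM.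
Proof.
move=> X; apply/matrixP => i j.
by rewrite mxE /ofM !insubT //= => i_d j_d; rewrite ofKK; congr (X _ _); exact: val_inj.
Qed.

Lemma meqP A B : meq d A B <-> toM A = toM B.
Proof.
split=> [AB|/matrixP AB i j /ssrnat.ltP i_d /ssrnat.ltP j_d].
  by apply/matrixP => i j; rewrite !mxE AB //; apply/ssrnat.ltP.
by have := AB (Ordinal i_d) (Ordinal j_d); rewrite !mxE => /toK_inj.
Qed.

Lemma toM_mul A B : toM (mmul d A B) = toM A *m toM B.
Proof.
apply/matrixP => i j; rewrite !mxE toK_csum.
by apply: eq_bigr => k _; rewrite !mxE toKM.
Qed.

Lemma toM_adj A : toM (adj A) = (toM A)^t*.
Proof. by apply/matrixP => i j; rewrite !mxE toK_conj. Qed.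

Lemma toM_id : toM idM = 1%:M.
Proof.
apply/matrixP => i j; rewrite !mxE /idM -val_eqE /=.
by case: eqP => [->|/eqP/negPf]; rewrite ?Nat.eqb_refl // => /eqP/Nat.eqb_neq ->.
Qed.

Definition dmx l : 'M[K]_d := diag_mx (\row_i (l i)%:K).

Lemma toM_diag l : toM (diagM l) = dmx l.
Proof.
apply/matrixP => i j; rewrite !mxE /diagM -val_eqE /=.
by case: eqP => [->|/eqP/negPf]; rewrite ?Nat.eqb_refl // => /eqP/Nat.eqb_neq ->.
Qed.

Lemma toK_trace A : toK (trace d A) = \tr (toM A).
Proof. by rewrite toK_csum; apply: eq_bigr => i _; rewrite mxE. Qed.

Lemma unitaryP U : unitary d U <-> toM U \is unitarymx.
Proof.
rewrite /unitary !meqP !toM_mul toM_adj toM_id; split=> [[/unitarymxP//]|].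
by move=> uU; split; [exact/unitarymxP | exact: unitarymx_adjV].
Qed.

Lemma toM_conj U A : toM (conjU d U A) = toM U *m toM A *m (toM U)^t*.
Proof. by rewrite /conjU !toM_mul toM_adj. Qed.

Lemma spectralP A V l : spectral d A V l <->
  toM V \is unitarymx /\ toM A = toM V *m dmx l *m (toM V)^t*.
Proof. by rewrite /spectral unitaryP meqP toM_conj toM_diag. Qed.

End Dimension.
End Encoding.

(** * Relative entropy in terms of eigenvalues and eigenbasis overlaps *)

Section RelativeEntropy.
Local Open Scope ring_scope.
Local Open Scope sesquilinear_scope.
Local Notation "x %:K" := (real_complex R x : K) (at level 2, format "x %:K").

Definition sqmod (a : C) : R := fst a ^+ 2 + snd a ^+ 2.

Lemma sqmodE a : (sqmod a)%:K = toK a * (toK a)^*.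
Proof. by rewrite -normCK -add_Re2_Im2. Qed.

Lemma toK_real_sum n (f : 'I_n -> R) :
  \sum_(i < n) (f i)%:K = (\sum_(i < n) f i)%:K.
Proof. by rewrite [RHS](raddf_sum (real_complex R)). Qed.

Section Dimension.
Variable d : nat.
Implicit Types (A B U V W : Mat) (l m p q : nat -> R).
Local Notation toM := (toM d).
Local Notation dmx := (dmx d).

Lemma spectral_conj U A V l :
  unitary d U -> spectral d A V l -> spectral d (conjU d U A) (mmul d U V) l.
Proof.
move=> /unitaryP uU /spectralP[uV AV]; apply/spectralP.
rewrite toM_conj toM_mul AV trmx_mul map_mxM !mulmxA.
by split=> //; exact: mul_unitarymx.
Qed.

(** The decomposition chosen by [epsilon] is valid because the given one witnesses existence;
    uniqueness of the functional calculus then exchanges the two. *)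
Lemma toM_funM (f : R -> R) A V l : spectral d A V l ->
  toM (funM d f A) = toM V *m dmx (f \o l) *m (toM V)^t*.
Proof.
move=> AVl; rewrite /funM toM_conj toM_diag.
set P := (X in epsilon _ X); set e := epsilon _ P.
have : P e by apply: epsilon_spec; exists (V, l).
case: e => W m /= /spectralP[uW AW]; have /spectralP[uV AV] := AVl.
(* The diagonals live in [K], so [f] is extended to [K] by reading off the real part. *)
pose g (z : K) : K := (f (complex.Re z))%:K.
have dmxE k : dmx (f \o k) = diag_mx (map_mx g (\row_i (k i)%:K)).
  by congr diag_mx; apply/rowP => i; rewrite !mxE.
rewrite -[fun i => _]/(f \o m) !dmxE; apply: spectral_fun_unique => //.
by rewrite -/(dmx l) -/(dmx m) -AV -AW.
Qed.

Lemma trace_diag_conj (T : 'M[K]_d) l m :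
  \tr (T *m dmx l *m T^t* *m dmx m) =
  \sum_(i < d) \sum_(j < d) T i j * (T i j)^* * (m i)%:K * (l j)%:K.
Proof.
rewrite /mxtrace; apply: eq_bigr => i _.
rewrite mul_mx_diag mxE [X in X * _]mxE mulr_suml; apply: eq_bigr => j _.
by rewrite mul_mx_diag !mxE; ring.
Qed.

(** Cyclicity of the trace removes [V] from the first term and leaves only the overlap [T = W^* V]
    in the second. *)
Lemma qrelent_spectral A B V W p q : spectral d A V p -> spectral d B W q ->
  qrelent d A B = \sum_(j < d) xlogx (p j) -
    \sum_(i < d) \sum_(j < d) sqmod (mmul d (adj W) V i j) * ln (q i) * p j.
Proof.
move=> AV BW; have [/spectralP[uV eA] /spectralP[uW eB]] := (AV, BW).
have ReE (z : C) (r : R) : toK z = r%:K -> Defs.Re z = r by move=> [].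
rewrite /qrelent RminusE; congr (_ - _); apply: ReE; rewrite toK_trace.
  rewrite (toM_funM _ AV) mxtrace_mulC mulmxA unitarymx_adjV // mul1mx.
  by rewrite mxtrace_diag -toK_real_sum; apply: eq_bigr => i _; rewrite mxE.
rewrite toM_mul (toM_funM _ BW) eA !mulmxA mxtrace_mulC !mulmxA.
set T := (toM W)^t* *m toM V.
have -> : T *m dmx p *m (toM V)^t* *m toM W *m dmx (ln \o q) =
          T *m dmx p *m T^t* *m dmx (ln \o q).
  by rewrite [in T^t*]/T trmx_mul map_mxM trmxCK !mulmxA.
rewrite trace_diag_conj -toK_real_sum; apply: eq_bigr => i _.
rewrite -toK_real_sum; apply: eq_bigr => j _; rewrite !rmorphM /= sqmodE.
have -> : T i j = toK (mmul d (adj W) V i j) by rewrite /T -toM_adj -toM_mul mxE.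
by [].
Qed.

(** Row sums are the diagonal entries of [U U^*]; column sums are row sums of the transpose, which
    is unitary too. *)
Lemma unitary_bistochastic U :
  unitary d U -> bistochastic d (fun i j => sqmod (U i j)).
Proof.
move=> /unitaryP uU.
have rowsum (X : 'M[K]_d) i : X \is unitarymx -> \sum_j X i j * (X i j)^* = 1.
  move=> /unitarymxP/matrixP/(_ i i); rewrite !mxE eqxx; apply: etrans.
  by apply: eq_bigr => j _; rewrite !mxE.
split=> [i j|i i_d|j j_d].
- by rewrite addr_ge0 ?sqr_ge0.
- apply: (@complexI R); rewrite -toK_real_sum -[RHS](rowsum _ (Ordinal i_d) uU).
  by apply: eq_bigr => j _; rewrite sqmodE mxE.
- apply: (@complexI R); rewrite -toK_real_sum.
  rewrite -trmx_unitary in uU; rewrite -[RHS](rowsum _ (Ordinal j_d) uU).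
  by apply: eq_bigr => i _; rewrite sqmodE !mxE.
Qed.

End Dimension.
End RelativeEntropy.

(** * Sorted lists and the finite case of the classical relative entropy *)

Section Lists.
Local Open Scope ring_scope.
Implicit Types s p q : seq R.

Lemma List_nthE s i : List.nth i s 0%R = s`_i.
Proof. by elim: s i => [|x s IHs] [|i] //=. Qed.

Lemma Sorted_RgeP s : reflect (Sorted Rge s) (sorted >=%R s).
Proof.
elim: s => [|x s IHs]; first by constructor; constructor.
have sE : sorted >=%R (x :: s) = (if s is y :: _ then y <= x else true) && sorted >=%R s.
  by case: s {IHs}.
rewrite sE; apply: (iffP andP) => [[xs /IHs ss]|xss].
  constructor=> //; case: s xs {IHs ss sE} => [|y s] yx; constructor.
  by apply/RIneq.Rle_ge/RleP.
have [ss xs] := Sorted_inv xss; split; last exact/IHs.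
by case: s xs {IHs ss xss sE} => // y s xs; apply/RleP/RIneq.Rge_le; exact: HdRel_inv xs.
Qed.

Lemma nonincreasing_nth d (l : seq R) : length l = d -> Sorted Rge l ->
  nonincreasing d (fun i => List.nth i l 0%R).
Proof.
move=> <- /Sorted_RgeP sl i j ij jl; rewrite !List_nthE.
apply: (@sorted_leq_nth _ >=%R _ _ 0 l sl i j) => //.
- by move=> y x z /= yx zy; exact: le_trans zy yx.
- by move=> x /=.
- exact: leq_ltn_trans jl.
Qed.

(** Positivity of [q] rules out the infinite branch, and [xlogx] absorbs the convention at 0. *)
Lemma relH_sum p q : length p = length q ->
  (forall i, (i < length p)%N -> 0 <= List.nth i p 0%R) ->
  (forall i, (i < length p)%N -> 0 < List.nth i q 0%R) ->
  relH p q = Some (\sum_(i < length p)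
    (xlogx (List.nth i p 0%R) - ln (List.nth i q 0%R) * List.nth i p 0%R)).
Proof.
elim: p q => [|x p IHp] [|y q] //=; first by rewrite big_ord0.
move=> /eq_add_S eq_pq p0 q0.
rewrite big_ord_recl IHp //=; last first.
- by move=> i ip; exact: (q0 i.+1).
- by move=> i ip; exact: (p0 i.+1).
have y0 : 0 < y := q0 0%N isT; have x0 : 0 <= x := p0 0%N isT.
rewrite /xlogx; case: RIneq.Req_EM_T => [->|xn0] /=.
  by case: Rle_dec => [_|[]]; [rewrite mulr0 subr0 add0r | exact: Rle_refl].
case: RIneq.Req_EM_T => [y00|_]; first by rewrite y00 ltxx in y0.
case: Rle_dec => [x_le0|_].
  by case: xn0; apply/le_anti; rewrite x0 andbT; exact/RleP.
by rewrite !RplusE !RmultE RminusE mulrBr [ln y * x]mulrC.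
Qed.

End Lists.

(** * Ordered spectral decompositions and the signs of eigenvalues *)

Section Eigenvalues.
Local Open Scope ring_scope.
Local Open Scope sesquilinear_scope.
Local Notation "x %:K" := (real_complex R x : K) (at level 2, format "x %:K").
Variable d : nat.
Local Notation toM := (toM d).
Local Notation dmx := (dmx d).

Lemma col_perm_diag_conj (F : numClosedFieldType) (s : 'S_d) (X : 'M[F]_d) (l : 'rV_d) :
  col_perm s X *m diag_mx (col_perm s l) *m (col_perm s X)^t* =
  X *m diag_mx l *m X^t*.
Proof.
apply/matrixP => i j; rewrite !mul_mx_diag !mxE [RHS](reindex_inj (@perm_inj _ s)).
by apply: eq_bigr => k _; rewrite !mxE.
Qed.

(** The spectral theorem gives real eigenvalues in no particular order; sorting them permutes the
    columns of the eigenvector matrix, which leaves the product unchanged. *)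
Lemma hermitian_eig_dec A : hermitian d A -> eig_dec_spec d A (eig_dec d A).
Proof.
move=> hA; apply: epsilon_spec.
have symA : toM A \is hermsymmx.
  apply/is_hermitianmxP; rewrite expr0 scale1r; apply/matrixP => i j.
  by rewrite !mxE -toK_conj -hA //; apply/ssrnat.ltP.
have /orthomx_spectralP := hermitian_normalmx symA.
have /mxOverP realA := hermitian_spectral_diag_real symA.
set P := spectralmx _ => eA.
have uP : P \is unitarymx := spectral_unitarymx _.
pose t := [tuple complex.Re (spectral_diag (toM A) 0 i) | i < d].
have /tuple_permP[s def_s] : perm_eq (sort >=%R t) t by rewrite perm_sort.
exists (sort >=%R t); split; [|split].
- by rewrite -[LHS]/(size _) size_sort size_tuple.
- by apply/Sorted_RgeP/sort_sorted => x y; exact: le_total.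
pose V := col_perm s (P^t*); exists (ofM V); apply/spectralP; rewrite ofMK.
have dE : dmx (fun i => List.nth i (sort >=%R t) 0%R) =
          diag_mx (col_perm s (spectral_diag (toM A))).
  congr diag_mx; apply/rowP => i; rewrite !mxE List_nthE def_s.
  by rewrite (nth_map i) ?size_enum_ord // nth_ord_enum tnth_mktuple RRe_real.
split; last by rewrite dE col_perm_diag_conj trmxCK -invmx_unitary.
have uP' : P^t* \is unitarymx by rewrite trmxC_unitary.
apply/unitarymxP; rewrite -[RHS](unitarymxP uP').
(* With all eigenvalues equal to 1, the permutation invariance reads [V V^* = P^* P], so [V] is
   unitary. *)
have colc : const_mx 1 = col_perm s (const_mx 1) :> 'rV[K]_d.
  by apply/rowP => i; rewrite !mxE.
have := @col_perm_diag_conj K s (P^t*) (const_mx 1).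
by rewrite -colc diag_const_mx !mulmx1.
Qed.

Lemma spectral_adj_conj A V l : spectral d A V l ->
  (toM V)^t* *m toM A *m toM V = dmx l.
Proof.
move=> /spectralP[uV ->].
by rewrite !mulmxA unitarymx_adjV // mul1mx -mulmxA unitarymx_adjV // mulmx1.
Qed.

(** The quadratic form of [A] at the [i]-th column of [V] takes the value [l i]. *)
Lemma psd_eigenvalue_ge0 A V l i :
  psd d A -> spectral d A V l -> (i < d)%N -> 0 <= l i.
Proof.
move=> [_ psdA] AVl i_d; pose i' := Ordinal i_d.
have := psdA (fun k => V k i) => /RleP; rewrite -/(mmul d A V _ i).
have -> : csum d (fun k => Cmul (Cconj (V k i)) (csum d (fun j => Cmul (A k j) (V j i))))
        = mmul d (adj V) (mmul d A V) i i by [].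
have : toK (mmul d (adj V) (mmul d A V) i i) = (l i)%:K.
  have /matrixP/(_ i' i') := spectral_adj_conj AVl.
  by rewrite -toM_adj -mulmxA -!toM_mul !mxE eqxx.
by case: (mmul _ _ _ _ _) => x y [-> _].
Qed.

(** In the eigenbasis the diagonal matrix has the right inverse [V^* B V]; a zero eigenvalue would
    annihilate row [i] of the product. *)
Lemma invertible_eigenvalue_neq0 A V l i :
  invertible d A -> spectral d A V l -> (i < d)%N -> l i != 0.
Proof.
move=> [B [/meqP AB _]] AVl i_d; pose i' := Ordinal i_d.
move: AB; rewrite toM_mul toM_id => AB; apply/eqP => li0.
have /spectralP[uV _] := AVl.
have : dmx l *m ((toM V)^t* *m toM B *m toM V) = 1%:M.
  rewrite -(spectral_adj_conj AVl) !mulmxA mulmxtVK // -[_ *m toM A *m _]mulmxA AB.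
  by rewrite mulmx1 unitarymx_adjV.
rewrite mul_diag_mx => /matrixP/(_ i' i'); rewrite !mxE li0 mul0r eqxx => /eqP.
by rewrite eq_sym oner_eq0.
Qed.

End Eigenvalues.

(** * Unitaries interpolating between the identity and the reversal *)

Section ReversalMix.
Local Open Scope ring_scope.
Local Open Scope sesquilinear_scope.
Local Notation "x %:K" := (real_complex R x : K) (at level 2, format "x %:K").
Variable d : nat.
Local Notation toM := (toM d).

(* sqrt(c) 1 + i sqrt(1 - c) J, where J is the reversal permutation matrix. *)
Definition reversal_mix (c : R) : Mat := fun i j =>
  (if i == j then Num.sqrt c else 0,
   if i == (d - j.+1)%N then Num.sqrt (1 - c) else 0).

Lemma reversal_mix_unitary (c : R) : 0 <= c <= 1 -> unitary d (reversal_mix c).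
Proof.
case/andP => c0 c1; apply/unitaryP/unitarymxP.
pose s := perm (@rev_ord_inj d); pose J : 'M[K]_d := perm_mx s.
have ss : (s * s = 1)%g by apply/permP => i; rewrite permM !permE rev_ordK.
have JJ : J *m J = 1%:M by rewrite -perm_mxM ss perm_mx1.
have Jadj : J^t* = J.
  by rewrite tr_perm_mx map_perm_mx; congr perm_mx; apply/eqP; rewrite eq_invg_mul ss.
pose x := (Num.sqrt c)%:K; pose y : K := 'i * (Num.sqrt (1 - c))%:K.
have -> : toM (reversal_mix c) = x%:M + y *: J.
  apply/matrixP => i j; rewrite !mxE permE /reversal_mix /toK /= -val_eqE /=.
  have -> : (i == d - j.+1 :> nat)%N = (rev_ord i == j).
    rewrite -val_eqE /=; have := ltn_ord i; have := ltn_ord j.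
    by move=> ? ?; apply/eqP/eqP; lia.
  rewrite /y -complexiE; case: eqP => _; case: eqP => _; rewrite /x;
    apply/eqP; rewrite eq_complex /=; apply/andP; split; apply/eqP => /=; ring.
have xadj : x^* = x by exact: conjc_real.
have yadj : y^* = - y.
  by rewrite rmorphM /= conjCi mulNr; congr (- (_ * _)); exact: conjc_real.
have -> : (x%:M + y *: J)^t* = x%:M - y *: J.
  rewrite linearD map_mxD /= tr_scalar_mx map_scalar_mx linearZ /= map_mxZ Jadj.
  by rewrite -scaleNr; congr (_%:M + _ *: _).
(* In [(x + y J)(x - y J)] the cross terms cancel and [J J = 1] leaves [x^2 - y^2 = c + (1 - c)]. *)
rewrite mulmxBr !mulmxDl -!scalemxAl -!scalemxAr JJ !mul_scalar_mx !mul_mx_scalar.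
rewrite scale_scalar_mx !scalerA [y * x]mulrC opprD addrA addrK.
have -> : y * y = - (1 - c)%:K.
  by rewrite mulrACA -expr2 sqrCi mulN1r -rmorphM -expr2 sqr_sqrtr ?subr_ge0.
have -> : x * x = c%:K by rewrite -rmorphM -expr2 sqr_sqrtr.
by rewrite scaleNr opprK scalemx1 -raddfD /= -rmorphD addrC subrK.
Qed.

(** The identity sits in the real parts and the reversal in the imaginary parts, so their squares
    add without a cross term, even at the central entry for odd [d], where both are present. *)
Lemma reversal_mix_sum (c : R) (a b : nat -> R) : 0 <= c <= 1 ->
  \sum_(i < d) \sum_(j < d) sqmod (reversal_mix c i j) * a i * b j =
  c * (\sum_(i < d) a i * b i) + (1 - c) * (\sum_(i < d) a (d - i.+1)%N * b i).
Proof.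
case/andP => c0 c1; rewrite exchange_big /= !mulr_sumr -big_split /=.
apply: eq_bigr => j _.
under eq_bigr => i _ do rewrite /sqmod /= !mulrDl.
rewrite big_split /=; congr (_ + _).
  rewrite (bigD1 j) //= eqxx sqr_sqrtr // mulrA big1 ?addr0 // => i /negPf.
  by rewrite -val_eqE /= => ->; rewrite expr0n /= !mul0r.
rewrite (bigD1 (rev_ord j)) //= eqxx sqr_sqrtr ?subr_ge0 // mulrA big1 ?addr0 //.
by move=> i /negPf; rewrite -val_eqE /= => ->; rewrite expr0n /= !mul0r.
Qed.

End ReversalMix.

(** * Values of the relative entropy along the unitary orbit *)

Section Orbit.
Local Open Scope ring_scope.
Local Open Scope sesquilinear_scope.
Variable d : nat.

Definition relent_overlap (T : Mat) (p q : nat -> R) : R :=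
  \sum_(j < d) xlogx (p j) -
  \sum_(i < d) \sum_(j < d) sqmod (T i j) * ln (q i) * p j.

(** The map sending [U] to [W^* U V] permutes the unitary group, with inverse sending [T] to
    [W T V^*]. *)
Lemma qrelent_orbit A B V W p q s : spectral d A V p -> spectral d B W q ->
  (exists U, unitary d U /\ qrelent d (conjU d U A) B = s) <->
  (exists2 T, unitary d T & relent_overlap T p q = s).
Proof.
move=> AV BW; have [/spectralP[uV _] /spectralP[uW _]] := (AV, BW).
split=> [[U [uU <-]]|[T /unitaryP uT <-]].
  exists (mmul d (adj W) (mmul d U V)); last first.
    by rewrite (qrelent_spectral (spectral_conj uU AV) BW).
  apply/unitaryP; rewrite !toM_mul toM_adj.
  by rewrite !mul_unitarymx ?trmxC_unitary //; exact/unitaryP.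
pose U := ofM (toM d W *m toM d T *m (toM d V)^t*).
have uU : unitary d U.
  by apply/unitaryP; rewrite ofMK !mul_unitarymx ?trmxC_unitary.
exists U; split=> //; rewrite (qrelent_spectral (spectral_conj uU AV) BW).
have /meqP UT : toM d (mmul d (adj W) (mmul d U V)) = toM d T.
  rewrite !toM_mul toM_adj ofMK !mulmxA unitarymx_adjV // mul1mx.
  by rewrite -mulmxA unitarymx_adjV // mulmx1.
congr (_ - _); apply: eq_bigr => i _; apply: eq_bigr => j _.
by rewrite UT //; apply/ssrnat.ltP.
Qed.

Lemma relent_overlap_range (p q : nat -> R) (s : R) :
  nonincreasing d p -> nonincreasing d (ln \o q) ->
  let E : R := \sum_(j < d) xlogx (p j) in
  (exists2 T, unitary d T & relent_overlap T p q = s) <->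
  E - \sum_(i < d) ln (q i) * p i <= s <= E - \sum_(i < d) ln (q (d - i.+1)%N) * p i.
Proof.
move=> dp dq E; split=> [[T uT <-]|].
  have bT := unitary_bistochastic uT.
  by rewrite /relent_overlap !lerD2l !lerN2 (bistochastic_le bT dq dp)
             (bistochastic_ge bT dq dp).
set hi : R := \sum_(i < d) ln (q i) * p i.
set lo : R := \sum_(i < d) ln (q (d - i.+1)%N) * p i => /andP[ge_s le_s].
have [c c01 ->] : exists2 c : R, 0 <= c <= 1 & s = E - (c * hi + (1 - c) * lo).
  have [hilo|hilo] := eqVneq hi lo.
    by exists 1; rewrite ?ler01 ?lexx //; lra.
  (* The bounds on [s] force [lo <= hi]; once these differ, [c] is the solution of a linear
     equation, and the same bounds place it in [0,1]. *)
  have lt_lohi : 0 < hi - lo by rewrite lt_def subr_eq0 hilo; lra.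
  exists ((E - s - lo) / (hi - lo)); last by field; rewrite gt_eqF.
  by rewrite divr_ge0 ?ler_pdivrMr // ?mul1r; lra.
exists (reversal_mix d c); first exact: reversal_mix_unitary.
by rewrite /relent_overlap (@reversal_mix_sum d c (ln \o q) p c01).
Qed.

End Orbit.

(** * The entropy range for density matrices with sorted spectra *)

Theorem theorem3 (d : nat) (rho sigma : Mat) :
  density d rho -> density d sigma -> invertible d sigma ->
  exists hmin hmax : R,
    relH (eig_dec d rho) (eig_dec d sigma) = Some hmin /\
    relH (eig_dec d rho) (eig_inc d sigma) = Some hmax /\
    (* min over unitaries *)
    (exists U, unitary d U /\ qrelent d (conjU d U rho) sigma = hmin) /\
    (forall U, unitary d U -> hmin <= qrelent d (conjU d U rho) sigma) /\
    (* max over unitaries *)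
    (exists U, unitary d U /\ qrelent d (conjU d U rho) sigma = hmax) /\
    (forall U, unitary d U -> qrelent d (conjU d U rho) sigma <= hmax) /\
    (* the range is the closed interval *)
    (forall s : R,
       (exists U, unitary d U /\ qrelent d (conjU d U rho) sigma = s) <->
       hmin <= s <= hmax).
Proof.
move=> [psd_rho _] [psd_sigma _] inv_sigma.
have [len_p [dec_p [V spV]]] := hermitian_eig_dec (proj1 psd_rho).
have [len_q [dec_q [W spW]]] := hermitian_eig_dec (proj1 psd_sigma).
set p := fun i => _ in spV; set q := fun i => _ in spW.
have p_ge0 i : (i < d)%N -> (0 <= p i)%R by apply: psd_eigenvalue_ge0 spV.
have q_gt0 i : (i < d)%N -> (0 < q i)%R.
  move=> i_d; rewrite lt_def (invertible_eigenvalue_neq0 inv_sigma spW i_d).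
  exact: psd_eigenvalue_ge0 spW i_d.
have dp : nonincreasing d p by exact: nonincreasing_nth.
(* The logarithm preserves the order because all eigenvalues of [sigma] are positive; ties are split
   off since [ln_increasing] is strict. *)
have dlnq : nonincreasing d (ln \o q).
  move=> i j ij jd; rewrite /=.
  have := nonincreasing_nth len_q dec_q ij jd; rewrite le_eqVlt => /orP[/eqP|] qij.
    by rewrite /q qij.
  by apply/RleP/Rlt_le/ln_increasing; apply/RltP => //; exact: q_gt0.
have rev_q i : (i < d)%N -> List.nth i (eig_inc d sigma) 0 = q (d - i.+1)%N.
  by move=> /ssrnat.ltP i_d; rewrite rev_nth len_q.
pose E := (\sum_(j < d) xlogx (p j))%R.
pose hmin := (E - \sum_(i < d) ln (q i) * p i)%R.
pose hmax := (E - \sum_(i < d) ln (q (d - i.+1)%N) * p i)%R.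
have range s := iff_trans (qrelent_orbit s spV spW) (relent_overlap_range s dp dlnq).
(* A nonempty orbit yields [hmin <= hmax], without which the endpoints would not lie in the
   interval. *)
have U1 : exists U, unitary d U by exists V; case: spV.
have {}range s : (exists U, unitary d U /\ qrelent d (conjU d U rho) sigma = s) <->
  hmin <= s <= hmax.
  rewrite (range s); split=> [/andP[/RleP ? /RleP ?] //|[/RleP ? /RleP ?]].
  exact/andP.
have in_range U : unitary d U -> hmin <= qrelent d (conjU d U rho) sigma <= hmax.
  by move=> uU; apply/range; exists U.
have le_h : hmin <= hmax by case: U1 => U /in_range[]; exact: Rle_trans.
exists hmin, hmax; split; [|split; [|split; [|split; [|split; [|split]]]]] => //.
- by rewrite relH_sum ?len_p ?len_q // sumrB.
- rewrite relH_sum ?len_p ?length_rev ?len_q //.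
    congr Some; rewrite sumrB; congr (_ - _)%R.
    by apply: eq_bigr => i _; rewrite rev_q.
  by move=> i i_d; rewrite rev_q // q_gt0 //; lia.
- by apply/range; split=> //; exact: Rle_refl.
- by move=> U /in_range[].
- by apply/range; split=> //; exact: Rle_refl.
- by move=> U /in_range[].
Qed.
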